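(* Let $k$ be a perfect field of characteristic $p>0$, let $n\ge1$, and let $J\subset k[x_1,\ldots,x_n]$ be the radical ideal of a nonempty finite set of $k$-rational points in $\mathbb{A}^n_k$. Put $a_0=0$ and $a_t=\alpha(J^{(t)})$ for $t\ge 1$. Then for every integer $t\ge1$, $$a_t\ge a_{t-1}+1.$$ More generally, for all integers $t\ge m\ge0$, $$a_t\ge a_m+t-m.$$
   Context: Let $R=k[x_1,\ldots,x_n]$. For distinct points $P_i=(a_{i1},\ldots,a_{in})\in k^n$, $i=1,\ldots,s$, with maximal ideals $\mathfrak m_i=(x_1-a_{i1},\ldots,x_n-a_{in})$, the radical ideal of the set $\{P_1,\ldots,P_s\}$ is $J=\bigcap_{i=1}^s\mathfrak m_i$, and its symbolic powers are $J^{(r)}=\bigcap_{i=1}^s\mathfrak m_i^r$ for $r\ge1$, with the convention $J^{(0)}=R$. For a nonzero (not necessarily homogeneous) ideal $L\subseteq R$, the initial degree is $\alpha(L)=\min\{\deg f\mid 0\ne f\in L\}$, where $\deg$ is the total degree. *)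

(* Defs.v *)
From HB Require Import structures.
From mathcomp Require Import all_boot all_order all_algebra.
From mathcomp Require Import mpoly.
From mathcomp Require Import boolp classical_sets.

Set Implicit Arguments.
Unset Strict Implicit.
Unset Printing Implicit Defensive.

Import GRing.Theory.
Local Open Scope ring_scope.
Local Open Scope classical_set_scope.

(* Vacuous in characteristic 0, where every field is perfect. *)
Definition perfect_field (k : fieldType) : Prop :=
  forall (p : nat) (charkp : p \in [pchar k]),
    forall x : k, exists y : k, pFrobenius_aut charkp y = x.

Section Ideals.
Variable R : comNzRingType.
Implicit Types S I : set R.

Definition ideal_gen S : set R :=
  [set f | exists (m : nat) (c g : 'I_m -> R),
     (forall i, S (g i)) /\ f = \sum_(i < m) c i * g i].

(* For r = 0 the only generator is the empty product, so the result is R. *)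
Definition ideal_exp I (r : nat) : set R :=
  ideal_gen [set f | exists g : 'I_r -> R,
     (forall i, I (g i)) /\ f = \prod_(i < r) g i].

Lemma mem_ideal_gen S f : S f -> ideal_gen S f.
Proof.
move=> Sf; exists 1%N, (fun=> 1), (fun=> f); split=> //.
by rewrite big_ord1 mul1r.
Qed.

Lemma ideal_genM S c f : ideal_gen S f -> ideal_gen S (c * f).
Proof.
move=> [m [d [g [Sg ->]]]]; exists m, (fun i => c * d i), g; split=> //.
by rewrite mulr_sumr; apply: eq_bigr => i _; rewrite mulrA.
Qed.

Lemma ideal_genD S f g : ideal_gen S f -> ideal_gen S g -> ideal_gen S (f + g).
Proof.
move=> [m [c [u [Su ->]]]] [l [d [v [Sv ->]]]].
pose glue T (x : 'I_m -> T) (y : 'I_l -> T) (i : 'I_(m + l)) :=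
  match split i with inl j => x j | inr j => y j end.
exists (m + l)%N, (glue R c d), (glue R u v); split.
  by move=> i; rewrite /glue; case: (split i).
rewrite big_split_ord /glue; congr (_ + _); apply: eq_bigr => i _.
  by rewrite (unsplitK (inl i)).
by rewrite (unsplitK (inr i)).
Qed.

Lemma ideal_gen_id S : ideal_gen (ideal_gen S) = ideal_gen S.
Proof.
apply/seteqP; split=> [f [m [c [g [Sg ->]]]]|f]; last exact: mem_ideal_gen.
elim/big_ind: _ => [|f1 f2|i _]; last exact: ideal_genM.
  by exists 0%N, (fun=> 0), (fun=> 0); split=> [[]//|]; rewrite big_ord0.
exact: ideal_genD.
Qed.

Lemma ideal_exp0 I : ideal_exp I 0 = [set: R].
Proof.
apply/seteqP; split=> // f _; rewrite -[f]mulr1.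
apply/ideal_genM/mem_ideal_gen; exists (fun=> 0); split=> [[]//|].
by rewrite big_ord0.
Qed.

Lemma ideal_exp1 I : ideal_exp I 1 = ideal_gen I.
Proof.
congr ideal_gen; apply/seteqP; split=> [f [g [Ig ->]]|f If].
  by rewrite big_ord1.
by exists (fun=> f); split=> //; rewrite big_ord1.
Qed.

End Ideals.

Section Points.
Variables (k : fieldType) (n : nat).
Implicit Type L : set {mpoly k[n]}.

Definition point_ideal (a : 'rV[k]_n) : set {mpoly k[n]} :=
  ideal_gen (range (fun j : 'I_n => 'X_j - (a 0 j)%:MP)).

Definition radical_ideal (s : nat) (P : 'I_s -> 'rV[k]_n) : set {mpoly k[n]} :=
  \bigcap_i point_ideal (P i).

Definition symbolic_power (s : nat) (P : 'I_s -> 'rV[k]_n) (r : nat) :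
    set {mpoly k[n]} :=
  \bigcap_i ideal_exp (point_ideal (P i)) r.

Lemma symbolic_power0 s (P : 'I_s -> 'rV[k]_n) :
  symbolic_power P 0 = [set: {mpoly k[n]}].
Proof. by apply/seteqP; split=> // f _ i _; rewrite ideal_exp0. Qed.

Lemma symbolic_power1 s (P : 'I_s -> 'rV[k]_n) :
  symbolic_power P 1 = radical_ideal P.
Proof.
by apply: eq_bigcapr => i _; rewrite ideal_exp1 /point_ideal ideal_gen_id.
Qed.

(* [msize f] is the total degree plus one when f != 0. *)
Definition totdeg (f : {mpoly k[n]}) : nat := (msize f).-1.

(* The value is 0 when L contains no nonzero polynomial. *)
Definition alpha L : nat :=
  xget 0%N [set d | (exists f, [/\ L f, f != 0 & totdeg f = d]) /\
                    (forall f, L f -> f != 0 -> (d <= totdeg f)%N)].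

Lemma alphaP L : (exists2 f, L f & f != 0) ->
  (exists f, [/\ L f, f != 0 & totdeg f = alpha L]) /\
  (forall f, L f -> f != 0 -> (alpha L <= totdeg f)%N).
Proof.
move=> [f0 Lf0 f0N0]; rewrite /alpha.
case: xgetP => [d _ //|noD]; exfalso.
have exD : exists d, `[< exists f, [/\ L f, f != 0 & totdeg f = d] >].
  by exists (totdeg f0); apply/asboolP; exists f0.
case: (ex_minnP exD) => d /asboolP dP dmin; apply: (noD d); split=> // f Lf fN0.
by apply: dmin; apply/asboolP; exists f.
Qed.

Definition initial_seq (s : nat) (P : 'I_s -> 'rV[k]_n) (t : nat) : nat :=
  if t is 0 then 0%N else alpha (symbolic_power P t).

End Points.

(* Main.v *)
Require Import Defs.
From HB Require Import structures.
From mathcomp Require Import all_boot all_order all_algebra.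
From mathcomp Require Import mpoly.
From mathcomp Require Import boolp classical_sets.

(** Write [J^(r)] for the [r]-th symbolic power.  Everything reduces to a
    descent: a nonzero [f] in [J^(r+1)] yields a nonzero [h] in [J^(r)] of
    smaller degree ([symbolic_power_descent]).  Applied to an [f] of least
    degree it makes the sequence of initial degrees strictly increasing, and
    the general inequality follows by summation.

    A partial derivative of [f] lies in [J^(r)], since by the Leibniz rule
    differentiation lowers the order of vanishing by at most one
    ([ideal_exp_mderiv]), and if nonzero it has smaller degree than [f]
    ([totdeg_mderiv]).  So any nonzero partial derivative of [f] serves as [h].

    If all partial derivatives vanish, only monomials whose exponents are
    divisible by [p] occur in [f], and perfectness of the field lets one take
    [p]-th roots of the coefficients, so that [f = g ^ p]
    ([mderiv0_exp_char]).  Raising to the power [p] multiplies the order of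
    vanishing at a point by exactly [p], hence [g] lies in [J^(q+1)] with
    [q = floor (r / p)].  As [g] is not constant, its degree is smaller than
    that of [f], so induction on the degree gives [h'] in [J^(q)] with
    [deg h' < deg g].  Then [h = g ^ (p - 1) * h'] lies in the symbolic power
    of index [(q + 1) (p - 1) + q = (q + 1) p - 1 >= r], and
    [deg h < p deg g = deg f].

    The order of vanishing is read off coefficients: a polynomial belongs to
    the [r]-th power of the maximal ideal of a point [a] exactly when its
    translate, which moves [a] to the origin, has no monomial of degree less
    than [r] ([point_idealP]).  In characteristic [p] the coefficient of
    [h ^ p] at the monomial [p m] is the [p]-th power of that of [h] at [m]
    ([mcoeff_exp_char]), which compares the orders of [h] and [h ^ p]. *)

Set Implicit Arguments.
Unset Strict Implicit.
Unset Printing Implicit Defensive.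

(** * Powers of ideals *)

Section IdealPowers.
Local Open Scope ring_scope.
Import GRing.Theory.
Variable R : comNzRingType.
Implicit Types S I : set R.

(** Membership in [ideal_exp I r] is elsewhere used through this principle,
    which reduces a linear property to multiples of products of [r] elements
    of [I]. *)
Lemma ideal_gen_ind S (Q : R -> Prop) :
    Q 0 -> (forall f g, Q f -> Q g -> Q (f + g)) ->
    (forall c g, S g -> Q (c * g)) ->
  forall f, ideal_gen S f -> Q f.
Proof.
move=> Q0 QD QS f [m [c [g [Sg ->]]]].
by elim/big_ind: _ => // i _; apply: QS.
Qed.

Lemma ideal_gen0 S : ideal_gen S 0.
Proof.
by exists 0%N, (fun=> 0), (fun=> 0); split=> [[]//|]; rewrite big_ord0.
Qed.

Lemma ideal_exp_cons I r f g :
  I f -> ideal_exp I r g -> ideal_exp I r.+1 (f * g).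
Proof.
move=> If; move: g; apply: ideal_gen_ind => [|g1 g2|c _ [u [Iu ->]]].
- by rewrite mulr0; apply: ideal_gen0.
- by rewrite mulrDr; apply: ideal_genD.
rewrite mulrCA; apply/ideal_genM/mem_ideal_gen.
exists (fun i => oapp u f (unlift ord0 i)); split.
  by move=> i; case: unliftP => [j|] _ /=; [apply: Iu|].
rewrite big_ord_recl unlift_none; congr (_ * _).
by apply: eq_bigr => i _; rewrite liftK.
Qed.

Lemma ideal_expM I a b f g :
  ideal_exp I a f -> ideal_exp I b g -> ideal_exp I (a + b) (f * g).
Proof.
move=> If Ig; move: f If; apply: ideal_gen_ind => [|f1 f2|c _ [u [Iu ->]]].
- by rewrite mul0r; apply: ideal_gen0.
- by rewrite mulrDl; apply: ideal_genD.
rewrite -mulrA; apply: ideal_genM.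
elim: a u Iu => [|a IHa] u Iu; first by rewrite big_ord0 mul1r.
by rewrite big_ord_recl -mulrA addSn; apply: ideal_exp_cons => //; apply: IHa.
Qed.

Lemma ideal_exp_mem I f : I f -> ideal_exp I 1 f.
Proof. by rewrite ideal_exp1; apply: mem_ideal_gen. Qed.

Lemma ideal_exp_one I : ideal_exp I 0 1.
Proof. by rewrite ideal_exp0. Qed.

Lemma ideal_exp_pow I a b f :
  ideal_exp I a f -> ideal_exp I (a * b) (f ^+ b).
Proof.
move=> If; elim: b => [|b IHb]; first by rewrite muln0; apply: ideal_exp_one.
by rewrite mulnS exprS; apply: ideal_expM.
Qed.

Lemma ideal_exp_prod I l (d : 'I_l -> nat) (F : 'I_l -> R) :
  (forall i, ideal_exp I (d i) (F i)) ->
  ideal_exp I (\sum_i d i) (\prod_i F i).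
Proof.
move=> IF; elim/big_ind2: _ => [|a f b g|i _] //; first exact: ideal_exp_one.
exact: ideal_expM.
Qed.

Lemma ideal_exp_le I a b f : (a <= b)%N -> ideal_exp I b f -> ideal_exp I a f.
Proof.
move=> /subnKC <-; elim: (b - a)%N => [|d IHd]; first by rewrite addn0.
rewrite addnS => If; apply: IHd; move: f If.
apply: ideal_gen_ind => [|f1 f2|c _ [u [Iu ->]]].
- exact: ideal_gen0.
- exact: ideal_genD.
rewrite big_ord_recl; do 2 apply: ideal_genM; apply: mem_ideal_gen.
by exists (fun i => u (lift ord0 i)).
Qed.

End IdealPowers.

(** * Polynomials: derivatives, order of vanishing, Frobenius *)

Section Polynomials.
Local Open Scope ring_scope.
Import GRing.Theory.
Variables (k : fieldType) (n : nat).
Implicit Types (f g h : {mpoly k[n]}) (I : set {mpoly k[n]}) (m : 'X_{1..n}).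

(** By the Leibniz rule, each term of the derivative of a multiple of a product
    of [r] factors from [I] retains at least [r.-1] of these factors. *)
Lemma ideal_exp_mderiv I r j f : ideal_exp I r f -> ideal_exp I r.-1 f^`M(j).
Proof.
case: r => [|r]; first by rewrite !ideal_exp0.
move: f; apply: ideal_gen_ind => [|f g|c _ [u [Iu ->]]].
- by rewrite mderiv0; apply: ideal_gen0.
- by rewrite mderivD; apply: ideal_genD.
have Iprod l (v : 'I_l -> {mpoly k[n]}) : (forall i, I (v i)) ->
    ideal_exp I l (\prod_i v i).
  by move=> Iv; apply: mem_ideal_gen; exists v.
rewrite mderivM; apply: ideal_genD.
  by apply/ideal_genM/(ideal_exp_le (leqnSn r))/Iprod.
apply: ideal_genM; rewrite -/(ideal_exp I r).
elim: r u Iu => [|r IHr] u Iu; first by rewrite ideal_exp0.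
rewrite big_ord_recl mderivM; apply: ideal_genD.
  by apply: ideal_genM; apply: Iprod.
by apply: ideal_exp_cons => //; apply: IHr.
Qed.

(** Vanishing at the origin; other points are brought there by [translate]. *)
Definition vanishes_to_order (r : nat) f :=
  forall m, (mdeg m < r)%N -> f@_m = 0.

Lemma vanishes_to_orderD r f g :
  vanishes_to_order r f -> vanishes_to_order r g -> vanishes_to_order r (f + g).
Proof. by move=> fr gr m lt_mr; rewrite mcoeffD fr ?gr ?addr0. Qed.

Lemma vanishes_to_orderM a b f g :
  vanishes_to_order a f -> vanishes_to_order b g ->
  vanishes_to_order (a + b) (f * g).
Proof.
move=> fa gb m lt_m; rewrite mcoeffM big1 // => -[m1 m2] /=.
move=> /eqP/(congr1 (@mdeg n)); rewrite mdegD => deg_m.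
case: (ltnP (mdeg m1) a) => [/fa->|le_a]; first by rewrite mul0r.
rewrite (gb m2) ?mulr0 //.
rewrite -(ltn_add2l a); apply: leq_ltn_trans lt_m.
by apply: (leq_trans _ (eq_leq (esym deg_m))); rewrite leq_add2r.
Qed.

(** The substitution [X_i := X_i + a_i] makes the behaviour of [f] at [a] that
    of [translate a f] at the origin. *)
Definition translate (a : 'rV[k]_n) f : {mpoly k[n]} :=
  f \mPo [tuple 'X_i + (a 0 i)%:MP | i < n].

Lemma translateD a f g : translate a (f + g) = translate a f + translate a g.
Proof. exact: rmorphD. Qed.

Lemma translateM a f g : translate a (f * g) = translate a f * translate a g.
Proof. exact: rmorphM. Qed.

Lemma translateXn a f r : translate a (f ^+ r) = translate a f ^+ r.
Proof. exact: rmorphXn. Qed.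

Lemma translateX a m :
  translate a 'X_[m] = \prod_(i < n) ('X_i + (a 0 i)%:MP) ^+ m i.
Proof.
by rewrite /translate comp_mpolyX; apply: eq_bigr => i _; rewrite tnth_mktuple.
Qed.

Lemma translateXU a i : translate a 'X_i = 'X_i + (a 0 i)%:MP.
Proof.
by rewrite /translate /comp_mpoly mmapX mmap1U tnth_mktuple.
Qed.

Lemma translateC a c : translate a c%:MP = c%:MP.
Proof. exact: comp_mpolyC. Qed.

Lemma translateE a f :
  translate a f =
    \sum_(m <- msupp f) f@_m *: \prod_(i < n) ('X_i + (a 0 i)%:MP) ^+ m i.
Proof.
rewrite {1}[f]mpolyE /translate raddf_sum; apply: eq_bigr => m _.
by rewrite /= linearZ /= -/(translate a _) translateX.
Qed.

Lemma translateK a : cancel (translate a) (translate (- a)).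
Proof.
move=> f; rewrite (translateE a) /translate raddf_sum /= [RHS]mpolyE.
apply: eq_bigr => m _; rewrite linearZ /= rmorph_prod /= mpolyXE_id.
congr (_ *: _); apply: eq_bigr => i _; rewrite rmorphXn /=; congr (_ ^+ _).
rewrite -/(translate _ _) translateD translateXU translateC.
by rewrite mxE mpolyCN addrNK.
Qed.

(** Generators of the ideal of [a] translate to variables, which gives one
    direction.  For the other, translating back the monomial expansion of
    [translate a f] writes [f] as a combination of products of powers of the
    [X_i - a_i] of total exponent at least [r]: its Taylor expansion at [a],
    obtained with no division by factorials. *)
Lemma point_idealP a r f :
  ideal_exp (point_ideal a) r f <-> vanishes_to_order r (translate a f).
Proof.
split.
  have order0 g : vanishes_to_order 0 g by [].
  have order_sum0 d : vanishes_to_order d (translate a 0).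
    by move=> m _; rewrite /translate raddf0 mcoeff0.
  have order1 g : point_ideal a g -> vanishes_to_order 1 (translate a g).
    move: g; apply: ideal_gen_ind => [|g1 g2|c _ [i _ <-]] //.
      by rewrite translateD; apply: vanishes_to_orderD.
    rewrite translateM; apply: (@vanishes_to_orderM 0 1) => //.
    rewrite -mpolyCN translateD translateXU translateC mpolyCN addrK => m.
    by rewrite ltnS leqn0 mdeg_eq0 => /eqP->; rewrite mcoeffX mnm1_eq0.
  move: f; apply: ideal_gen_ind => [|g1 g2|c _ [u [Iu ->]]] //.
    by rewrite translateD; apply: vanishes_to_orderD.
  rewrite translateM; apply: (@vanishes_to_orderM 0 r) => //.
  elim: r u Iu => [|r IHr] u Iu //.
  rewrite big_ord_recl translateM; apply: (@vanishes_to_orderM 1 r).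
    exact: order1.
  exact: IHr.
move=> fr; rewrite -[f](translateK a) translateE big_seq.
apply: big_ind => [|f1 f2|m m_supp]; first exact: ideal_gen0.
  exact: ideal_genD.
have {m_supp} le_r : (r <= mdeg m)%N.
  by rewrite leqNgt; apply: contraL m_supp => /fr fm0; rewrite -mcoeff_eq0 fm0.
rewrite -mul_mpolyC; apply/ideal_genM/(ideal_exp_le le_r).
rewrite mdegE; apply: ideal_exp_prod => i.
rewrite -[X in ideal_exp _ X]mul1n; apply/ideal_exp_pow/ideal_exp_mem.
by apply: mem_ideal_gen; exists i => //; rewrite mxE mpolyCN.
Qed.

Section Frobenius.
Variable p : nat.
Hypothesis charkp : p \in [pchar k].

(** The Frobenius map is additive, so it acts on each term separately. *)
Lemma mpoly_exp_char h :
  h ^+ p = \sum_(m <- msupp h) (h@_m ^+ p) *: 'X_[m *+ p].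
Proof.
have charp : p \in [pchar {mpoly k[n]}] by rewrite pchar_lalg.
rewrite {1}[h]mpolyE -(pFrobenius_autE charp) raddf_sum /=.
by apply: eq_bigr => m _; rewrite pFrobenius_autE exprZn mpolyXn.
Qed.

(** Since multiplication of exponents by [p] is injective, no two terms of the
    expansion of [h ^+ p] can merge or cancel. *)
Lemma mcoeff_exp_char h m : (h ^+ p)@_(m *+ p) = h@_m ^+ p.
Proof.
have p_gt0 : (0 < p)%N by rewrite prime_gt0 ?(pcharf_prime charkp).
have mulm_inj : injective (fun m => m *+ p)%MM.
  move=> m1 m2 /mnmP eq_m; apply/mnmP => i; move: (eq_m i).
  by rewrite !mulmnE => /eqP; rewrite eqn_pmul2r // => /eqP.
rewrite mpoly_exp_char raddf_sum /=.
under eq_bigr do rewrite mcoeffZ mcoeffX (inj_eq mulm_inj).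
case: (boolP (m \in msupp h)) => m_supp.
  rewrite (bigD1_seq m) ?msupp_uniq //= eqxx mulr1 big1 ?addr0 // => m'.
  by move/negPf->; rewrite mulr0.
rewrite (memN_msupp_eq0 m_supp) expr0n gtn_eqF // big_seq big1 // => m' m'_supp.
by case: eqP m_supp => [<-|_ _]; rewrite ?m'_supp ?mulr0.
Qed.

(** Raising to the power [p] multiplies the order by [p], so an order of
    [h ^+ p] exceeding [r * p] forces that of [h] to exceed [r]. *)
Lemma vanishes_to_order_exp_char t r h : (r * p < t)%N ->
  vanishes_to_order t (h ^+ p) -> vanishes_to_order r.+1 h.
Proof.
move=> lt_t hpt m; rewrite ltnS => le_m.
have := hpt (m *+ p)%MM; rewrite mcoeff_exp_char.
rewrite mdegMn (leq_ltn_trans _ lt_t) ?leq_mul2r ?le_m ?orbT // => /(_ isT)/eqP.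
by rewrite expf_eq0 => /andP[_ /eqP].
Qed.

(** The coefficient of [f^`M(i)] at [m - U_(i)] is [m i] times that of [f] at
    [m]; when it vanishes, [m i] is zero in [k], so [p] divides the exponent
    and the term has a [p]-th root, its coefficient having one. *)
Lemma mderiv0_exp_char f : perfect_field k -> (forall i, f^`M(i) = 0) ->
  exists g, f = g ^+ p.
Proof.
move=> perfk df0; have [root rootP] := choice (perfk p charkp).
have p_div m i : m \in msupp f -> (p %| m i)%N.
  rewrite mcoeff_msupp => fm; case def_mi: (m i) => [//|d].
  (* Truncated subtraction: [(m - U_(i)) + U_(i)] is [m] only if [0 < m i]. *)
  have le_i : (U_(i) <= m)%MM.
    by apply/mnm_lepP => j; rewrite mnm1E; case: eqP => [<-|//]; rewrite def_mi.
  have := mcoeff_mderiv i f (m - U_(i)); rewrite df0 mcoeff0 submK //.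
  rewrite mnmBE def_mi mnm1E eqxx subn1 -mulr_natr => /esym/eqP.
  by rewrite mulf_eq0 (negPf fm) -(dvdn_pcharf charkp).
have charp : p \in [pchar {mpoly k[n]}] by rewrite pchar_lalg.
exists (\sum_(m <- msupp f) root f@_m *: 'X_[[multinom m i %/ p | i < n]]).
rewrite -(pFrobenius_autE charp) raddf_sum {1}[f]mpolyE /= !big_seq.
apply: eq_bigr => m m_supp; rewrite pFrobenius_autE exprZn mpolyXn.
rewrite -(pFrobenius_autE charkp) rootP; congr (_ *: 'X_[_]).
by apply/mnmP => i; rewrite mulmnE mnmE divnK ?p_div.
Qed.

End Frobenius.

Lemma totdegM f g : f != 0 -> g != 0 ->
  totdeg (f * g) = (totdeg f + totdeg g)%N.
Proof.
move=> f0 g0; rewrite /totdeg msizeM // (mpolySpred _ f0) (mpolySpred _ g0) /=.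
by rewrite addnS.
Qed.

Lemma totdegX f r : f != 0 -> totdeg (f ^+ r) = (r * totdeg f)%N.
Proof.
move=> f0; elim: r => [|r IHr]; first by rewrite expr0 /totdeg msize1.
by rewrite exprS totdegM ?expf_neq0 // IHr mulSn.
Qed.

Lemma totdeg_mderiv i f : f^`M(i) != 0 -> (totdeg f^`M(i) < totdeg f)%N.
Proof.
move=> df0; have := mlead_supp df0; have := mlead_deg df0.
set m := mlead _; rewrite /totdeg => <- /=.
rewrite mcoeff_msupp mcoeff_mderiv => fm.
have m_supp : (m + U_(i))%MM \in msupp f.
  by rewrite mcoeff_msupp; apply: contraNneq fm => ->; rewrite mul0rn.
by have := msize_mdeg_lt m_supp; rewrite mdegD mdeg1 addn1; case: (msize f).
Qed.

End Polynomials.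

(** * Descent along symbolic powers *)

Section SymbolicPowers.
Local Open Scope ring_scope.
Import GRing.Theory.
Variables (k : fieldType) (n s : nat) (P : 'I_s -> 'rV[k]_n).
Implicit Types f g h : {mpoly k[n]}.

Lemma symbolic_powerP r f : symbolic_power P r f <->
  forall i, ideal_exp (point_ideal (P i)) r f.
Proof. by split=> [Jf i|Jf i _]; apply: Jf. Qed.

(** Guarantees that [alpha] of a symbolic power is a genuine minimum and not
    its default value. *)
Lemma symbolic_power_neq0 r : (0 < n)%N ->
  exists2 f, symbolic_power P r f & f != 0.
Proof.
move=> n_gt0; pose j := Ordinal n_gt0.
exists (\prod_i ('X_j - (P i 0 j)%:MP) ^+ r).
  apply/symbolic_powerP => i; rewrite (bigD1 i) //= mulrC.
  have Pj : point_ideal (P i) ('X_j - (P i 0 j)%:MP).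
    by apply: mem_ideal_gen; exists j.
  by apply: ideal_genM; have := ideal_exp_pow r (ideal_exp_mem Pj);
    rewrite mul1n.
apply/prodf_neq0 => i _; apply/expf_neq0/negP => /eqP/(congr1 (mcoeff U_(j))).
rewrite mcoeffB mcoeffXU mcoeffC mnm1_eq0 mulr0 eqxx subr0 mcoeff0.
by move/eqP; rewrite oner_eq0.
Qed.

(** A nonzero constant vanishes at no point, and there is at least one point. *)
Lemma symbolic_power_totdeg_gt0 r f : (0 < s)%N ->
  symbolic_power P r.+1 f -> f != 0 -> (0 < totdeg f)%N.
Proof.
move=> s_gt0 /symbolic_powerP/(_ (Ordinal s_gt0))/point_idealP Pf.
apply: contraNltn; rewrite leqn0 => /eqP deg_f.
have def_f : f = (f@_0)%:MP.
  apply: msize1_polyC.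
  by rewrite (leq_trans (leqSpred _)) // -/(totdeg f) deg_f.
by have := Pf 0%MM; rewrite def_f translateC mcoeffC mdeg0 eqxx mulr1 => ->.
Qed.

(** The induction is on the degree of [f], with [r] varying: when [f] is the
    [p]-th power of [g], the hypothesis is used at [g] and [r %/ p]. *)
Lemma symbolic_power_descent p r f :
    p \in [pchar k] -> perfect_field k -> (0 < s)%N ->
    symbolic_power P r.+1 f -> f != 0 ->
  exists h, [/\ symbolic_power P r h, h != 0 & (totdeg h < totdeg f)%N].
Proof.
move=> charkp perfk s_gt0.
have [d le_d] := ubnP (totdeg f); elim: d => // d IHd in r f le_d *.
move=> Jf f0.
have [[j dfj]|df0] := pselect (exists j, f^`M(j) != 0).
  exists f^`M(j); split=> //; last exact: totdeg_mderiv.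
  apply/symbolic_powerP => i; apply: (@ideal_exp_mderiv _ _ _ r.+1).
  by move: i; apply/symbolic_powerP.
have [g def_f] : exists g, f = g ^+ p.
  apply: mderiv0_exp_char => // j; apply/eqP; apply/negPn/negP => dfj.
  by apply: df0; exists j.
have p_gt1 : (1 < p)%N by rewrite prime_gt1 ?(pcharf_prime charkp).
have p_gt0 := ltnW p_gt1.
have g0 : g != 0.
  by apply: contra_neq f0; rewrite def_f => ->; rewrite expr0n gtn_eqF.
(* [q.+1] is the least [r'] with [r.+1 <= r' * p], the order forced on [g]. *)
pose q := (r %/ p)%N.
have Jg : symbolic_power P q.+1 g.
  apply/symbolic_powerP => i; apply/point_idealP.
  apply: (@vanishes_to_order_exp_char _ _ p charkp r.+1).
    exact: leq_trunc_div.
  rewrite -translateXn -def_f; apply/point_idealP.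
  by move: i; apply/symbolic_powerP.
have g_gt0 := symbolic_power_totdeg_gt0 s_gt0 Jg g0.
have deg_f : totdeg f = (p * totdeg g)%N by rewrite def_f totdegX.
have [h [Jh h0 lt_hg]] : exists h,
    [/\ symbolic_power P q h, h != 0 & (totdeg h < totdeg g)%N].
  by apply: IHd Jg g0; rewrite -ltnS (leq_trans _ le_d) // ltnS deg_f ltn_Pmull.
exists (g ^+ p.-1 * h); split; last 1 first.
- rewrite deg_f totdegM ?expf_neq0 // totdegX //.
  by rewrite -{2}(prednK p_gt0) mulSnr ltn_add2l.
- apply/symbolic_powerP => i.
  (* The right-hand side is [q.+1 * p - 1], and [r < q.+1 * p]. *)
  have le_r : (r <= q.+1 * p.-1 + q)%N.
    rewrite -ltnS -addnS -mulnSr prednK //; exact: ltn_ceil.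
  apply: (ideal_exp_le le_r); apply: ideal_expM.
    by apply: ideal_exp_pow; move: i; apply/symbolic_powerP.
  by move: i; apply/symbolic_powerP.
- by rewrite mulf_neq0 ?expf_neq0.
Qed.

End SymbolicPowers.

Theorem proposition4p1 (k : fieldType) (p : nat) (charkp : p \in [pchar k]%R)
  (perfk : perfect_field k) (n : nat) (n_ge1 : (1 <= n)%N)
  (s : nat) (s_gt0 : (0 < s)%N) (P : 'I_s -> 'rV[k]_n) (injP : injective P) :
  (forall t : nat, (1 <= t)%N ->
     (initial_seq P (t - 1) + 1 <= initial_seq P t)%N) /\
  (forall t m : nat, (m <= t)%N ->
     (initial_seq P m + (t - m) <= initial_seq P t)%N).
Proof.
have step t : (initial_seq P t < initial_seq P t.+1)%N.
  rewrite [initial_seq P t.+1]/=.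
  have [[f [Jf f0 <-]] _] := alphaP (symbolic_power_neq0 P t.+1 n_ge1).
  have [h [Jh h0]] := symbolic_power_descent charkp perfk s_gt0 Jf f0.
  move=> lt_hf; apply: leq_ltn_trans lt_hf; case: t Jh {Jf} => [|t] Jh //=.
  by have [_ ->] := alphaP (symbolic_power_neq0 P t.+1 n_ge1).
split=> [[//|t] _|t m /subnKC def_t]; first by rewrite subn1 addn1.
rewrite -{2}def_t; elim: (t - m)%N => [|d IHd]; first by rewrite !addn0.
by rewrite !addnS; apply: leq_ltn_trans IHd (step _).
Qed.
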